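(* Let $p\ge 1$ be an integer, $m=p(p+1)/2$, let $C>0$, $\mu>0$, $\tau>0$, $\gamma>0$ be real numbers and let $\check{\Sigma}$ be a real symmetric positive definite $p\times p$ matrix. Let $h_\tau$, its domain $\mathscr{D}\subset\mathbb{R}^m\times\mathbb{R}^m$, the index set $T_\gamma(\ell,s;C)$ and the map $F_\gamma(\ell,s;T)$ be as defined in the context, and consider the problem $$\min_{(\ell,s)\in\mathscr{D}}\ h_\tau(\ell,s)+C\|s\|_0. \qquad (P)$$ Then the following hold. 1) If $(\ell^*,s^* )\in\mathscr{D}$ is a $\gamma$-stationary point of $(P)$ such that $\operatorname{prox}_{\gamma C\|\cdot\|_0}\big(s^*-\gamma g_s(\ell^*,s^* )\big)=\{s^*\}$ (i.e. the proximal operator is single-valued there), then $$F_\gamma(\ell^*,s^*;T_* )=0\quad\text{with } T_*=T_\gamma(\ell^*,s^*;C).$$ 2) If $(\ell^*,s^* )\in\mathscr{D}$ satisfies $F_\gamma(\ell^*,s^*;T_* )=0$ with $T_*=T_\gamma(\ell^*,s^*;C)$, then $(\ell^*,s^* )$ is a $\gamma$-stationary point of $(P)$.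
   Context: Let $\mathbb{S}^p$ be the space of real symmetric $p\times p$ matrices with inner product $\langle U,V\rangle=\operatorname{tr}(UV)$, and fix an orthonormal basis $E_1,\dots,E_m$ of $\mathbb{S}^p$, $m=p(p+1)/2$ (for example, the matrices with a single $1$ on the diagonal, together with the symmetric matrices having $1/\sqrt{2}$ in positions $(i,j)$ and $(j,i)$, $i<j$, and zeros elsewhere). For $\ell,s\in\mathbb{R}^m$ put $L=\sum_{i=1}^m \ell_iE_i$ and $S=\sum_{j=1}^m s_jE_j$. Define $$\mathscr{D}=\{(\ell,s)\in\mathbb{R}^m\times\mathbb{R}^m:\ L\succ0,\ S\succ0\}$$ ($\succ 0$ means positive definite) and, for $(\ell,s)\in\mathscr{D}$, $$h_\tau(\ell,s)=\operatorname{tr}(L)+\mu\left\{\operatorname{tr}\big[(L+S)\check{\Sigma}^{-1}\big]-\log\det(L+S)\right\}-\tau\left[\log\det L+\log\det S\right].$$ Write $g_\ell(\ell,s)=\nabla_\ell h_\tau(\ell,s)\in\mathbb{R}^m$ and $g_s(\ell,s)=\nabla_s h_\tau(\ell,s)\in\mathbb{R}^m$ for the partial gradients, and $g_{s_i}(\ell,s)=\partial h_\tau(\ell,s)/\partial s_i$. $\|\cdot\|$ is the Euclidean norm and $\|s\|_0$ is the number of nonzero entries of the vector $s$. The set-valued proximal operator is $$\operatorname{prox}_{\gamma C\|\cdot\|_0}(x)=\operatorname*{argmin}_{v\in\mathbb{R}^m}\ C\|v\|_0+\tfrac{1}{2\gamma}\|v-x\|^2,\qquad x\in\mathbb{R}^m,$$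 where argmin denotes the set of all minimizers. For $\gamma>0$, a point $(\ell^*,s^* )\in\mathscr{D}$ is called a $\gamma$-stationary point of $(P)$ if $$g_\ell(\ell^*,s^* )=0\quad\text{and}\quad s^*\in\operatorname{prox}_{\gamma C\|\cdot\|_0}\big(s^*-\gamma g_s(\ell^*,s^* )\big).$$ For $(\ell,s)\in\mathscr{D}$ define the index set $$T_\gamma(\ell,s;C)=\left\{i\in\{1,\dots,m\}:\ |s_i-\gamma g_{s_i}(\ell,s)|\ge\sqrt{2\gamma C}\right\}.$$ For $T\subseteq\{1,\dots,m\}$ with complement $\bar{T}=\{1,\dots,m\}\setminus T$, and for a vector $x\in\mathbb{R}^m$ let $x_T$ denote the subvector with indices in $T$; define $$F_\gamma(\ell,s;T)=\begin{bmatrix} g_\ell(\ell,s)\\ \big(g_s(\ell,s)\big)_T\\ s_{\bar{T}}\end{bmatrix}\in\mathbb{R}^{2m}.$$ *)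

(* Defs.v *)
From mathcomp Require Export all_boot all_order all_algebra.
From mathcomp Require Export all_classical all_reals all_analysis.
Set Implicit Arguments.
Unset Strict Implicit.
Unset Printing Implicit Defensive.
Export Order.TTheory GRing.Theory Num.Theory.
Export numFieldNormedType.Exports.
Local Open Scope classical_set_scope.
Local Open Scope ring_scope.

Definition symdim (p : nat) : nat := ((p * (p + 1)) %/ 2)%N.

Section Matrices.
Variables (R : realType) (p m : nat).
Implicit Types (A U : 'M[R]_p) (E : 'I_m -> 'M[R]_p) (x : 'cV[R]_m).

Definition posdef A : Prop :=
  A^T = A /\ forall u : 'cV[R]_p, u != 0 -> 0 < (u^T *m A *m u) 0 0.

Definition mat_of E x : 'M[R]_p := \sum_i x i 0 *: E i.

Definition orthonormal_sym_basis E : Prop :=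
  [/\ forall i, (E i)^T = E i,
      forall i j, \tr (E i *m E j) = (i == j)%:R
    & forall U, U^T = U -> exists x, U = mat_of E x].

Definition domD E : set ('cV[R]_m * 'cV[R]_m) :=
  [set z | posdef (mat_of E z.1) /\ posdef (mat_of E z.2)].

End Matrices.

Section Vectors.
Variables (R : realType) (m : nat).
Implicit Types (x v : 'cV[R]_m) (f : 'cV[R]_m -> R) (T : {set 'I_m}).

(* The library norm on matrices is the sup norm, hence the explicit definition
   of the Euclidean one. *)
Definition enorm x : R := Num.sqrt (\sum_i x i 0 ^+ 2).

Definition l0norm x : nat := #|[set i | x i 0 != 0]%SET|.

(* Vector of the partial derivatives along the canonical basis; ['D_] is total,
   with an unspecified value where the derivative does not exist. *)
Definition grad f x : 'cV[R]_m := \col_i 'D_(delta_mx i 0) f x.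

Definition argmin (X : Type) (f : X -> R) : set X :=
  [set v | forall w, f v <= f w].

Definition prox_l0 (gamma C : R) x : set 'cV[R]_m :=
  argmin (fun v => C * (l0norm v)%:R + (2 * gamma)^-1 * enorm (v - x) ^+ 2).

Definition subvec T x : 'cV[R]_#|T| := \col_k x (enum_val k) 0.

End Vectors.

Section Problem.
Variables (R : realType) (p m : nat) (E : 'I_m -> 'M[R]_p).
Variables (mu tau : R) (Sigma : 'M[R]_p).
Implicit Types (l s : 'cV[R]_m) (T : {set 'I_m}).

(* Only meaningful on [domD E], which is open: elsewhere [ln] may be applied to
   a nonpositive determinant. *)
Definition h_tau l s : R :=
  let L := mat_of E l in let S := mat_of E s in
  \tr L + mu * (\tr ((L + S) *m invmx Sigma) - ln (\det (L + S)))
        - tau * (ln (\det L) + ln (\det S)).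

Definition g_l l s : 'cV[R]_m := grad (fun l' => h_tau l' s) l.
Definition g_s l s : 'cV[R]_m := grad (fun s' => h_tau l s') s.

Definition gamma_stationary (C gamma : R) l s : Prop :=
  [/\ domD E (l, s), g_l l s = 0
    & prox_l0 gamma C (s - gamma *: g_s l s) s].

Definition T_gamma (C gamma : R) l s : {set 'I_m} :=
  [set i | Num.sqrt (2 * gamma * C) <= `|s i 0 - gamma * g_s l s i 0|]%SET.

Lemma F_dim T : (m + (#|T| + #|~: T|) = 2 * m)%N.
Proof. by rewrite cardsC card_ord mul2n addnn. Qed.

(* The dependence on gamma is only through T. *)
Definition F_gamma l s T : 'cV[R]_(2 * m) :=
  castmx (F_dim T, erefl 1%N)
    (col_mx (g_l l s) (col_mx (subvec T (g_s l s)) (subvec (~: T) s))).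

End Problem.

(* Main.v *)
(* Writing x = s - gamma g_s, the proximal objective is the sum over i of
   C [v_i != 0] + (v_i - x_i)^2 / (2 gamma), so that it can be minimized coordinatewise.
   Off the origin the best value is C, attained at v_i = x_i only, while v_i = 0
   costs x_i^2 / (2 gamma).  Hence the minimizers are x_i when |x_i| > sqrt (2 gamma C),
   0 when |x_i| < sqrt (2 gamma C), and both at equality; there single-valuedness fails,
   which is why it is needed in the first part. *)
Require Import Defs.
Set Implicit Arguments.
Unset Strict Implicit.
Local Open Scope classical_set_scope.
Local Open Scope ring_scope.

Section HardThreshold.
Variables (R : realType) (C gamma : R).
Hypotheses (C_gt0 : 0 < C) (gamma_gt0 : 0 < gamma).

Definition l0_cost (x v : R) : R :=
  C * (v != 0)%:R + (2 * gamma)^-1 * (v - x) ^+ 2.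

Lemma l0_cost0 x : l0_cost x 0 = (2 * gamma)^-1 * x ^+ 2.
Proof. by rewrite /l0_cost eqxx mulr0 add0r sub0r sqrrN. Qed.

Lemma l0_cost_id x : l0_cost x x <= C.
Proof.
rewrite /l0_cost subrr expr0n mulr0 addr0.
by case: (x != 0); rewrite ?mulr1 ?mulr0 // ltW.
Qed.

Lemma l0_cost_ge x v : v != 0 -> C <= l0_cost x v.
Proof.
move=> v0; rewrite /l0_cost v0 mulr1 lerDl mulr_ge0 ?sqr_ge0 //.
by rewrite invr_ge0 mulr_ge0 // ltW.
Qed.

(** Squaring turns the test that defines [T_gamma] into a comparison of costs: the value 0 costs at
    least C, the price of a nonzero entry. *)
Lemma threshold_le x :
  (Num.sqrt (2 * gamma * C) <= `|x|) = (C <= l0_cost x 0).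
Proof.
rewrite l0_cost0 -sqrtr_sqr ler_sqrt ?sqr_ge0 //.
by rewrite ler_pdivlMl ?mulr_gt0.
Qed.

Lemma l0_cost_min_above x v :
  Num.sqrt (2 * gamma * C) <= `|x| -> l0_cost x x <= l0_cost x v.
Proof.
rewrite threshold_le => x_ge; apply: le_trans (l0_cost_id x) _.
by have [->|/(l0_cost_ge x)] := eqVneq v 0.
Qed.

Lemma l0_cost_min_below x v :
  `|x| < Num.sqrt (2 * gamma * C) -> l0_cost x 0 <= l0_cost x v.
Proof.
rewrite ltNge threshold_le -ltNge => x_lt.
have [->//|/(l0_cost_ge x) Cv] := eqVneq v 0.
exact: le_trans (ltW x_lt) Cv.
Qed.

Variable m : nat.
Implicit Types x v s : 'cV[R]_m.

Lemma prox_l0_objE x v :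
  C * (l0norm v)%:R + (2 * gamma)^-1 * enorm (v - x) ^+ 2
  = \sum_i l0_cost (x i 0) (v i 0).
Proof.
rewrite big_split /= -!mulr_sumr; congr (_ * _ + _ * _).
  rewrite /l0norm -sum1_card natr_sum big_mkcond /=.
  by apply: eq_bigr => i _; rewrite inE; case: ifP.
rewrite sqr_sqrtr; last by apply: sumr_ge0 => i _; exact: sqr_ge0.
by apply: eq_bigr => i _; rewrite !mxE.
Qed.

(** The objective is separable and the coordinates vary independently. *)
Lemma prox_l0P x s :
  prox_l0 gamma C x s <->
  forall i t, l0_cost (x i 0) (s i 0) <= l0_cost (x i 0) t.
Proof.
split=> [s_min i t|s_min w]; last first.
  by rewrite !prox_l0_objE; apply: ler_sum.
(* The competitor differs from [s] only at [i], so all other summands cancel. *)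
have := s_min (\col_j (if j == i then t else s j 0)).
rewrite !prox_l0_objE (bigD1 i) //= [leRHS](bigD1 i) //= mxE eqxx.
under [X in _ <= _ + X -> _]eq_bigr => j /negbTE ji do rewrite mxE ji.
by rewrite lerD2r.
Qed.

(** Putting [t] at coordinate [i] of [s] yields another minimizer, which uniqueness identifies with
    [s]. *)
Lemma prox_l0_set1 x s i t : prox_l0 gamma C x = [set s] ->
  l0_cost (x i 0) t <= l0_cost (x i 0) (s i 0) -> t = s i 0.
Proof.
move=> prox_s t_le.
have /prox_l0P s_min : prox_l0 gamma C x s by rewrite prox_s.
have : prox_l0 gamma C x (\col_j (if j == i then t else s j 0)).
  apply/prox_l0P => j u; rewrite mxE; case: eqP => [->|_]; last exact: s_min.
  exact: le_trans t_le (s_min _ _).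
by rewrite prox_s => /= <-; rewrite mxE eqxx.
Qed.

(** At equality 0 is also optimal for the coordinate; the singleton hypothesis excludes it. *)
Lemma prox_l0_set1_above x s i : prox_l0 gamma C x = [set s] ->
  Num.sqrt (2 * gamma * C) <= `|x i 0| -> s i 0 = x i 0.
Proof.
by move=> prox_s x_ge; rewrite (prox_l0_set1 prox_s (l0_cost_min_above _ x_ge)).
Qed.

Lemma prox_l0_set1_below x s i : prox_l0 gamma C x = [set s] ->
  `|x i 0| < Num.sqrt (2 * gamma * C) -> s i 0 = 0.
Proof.
by move=> prox_s x_lt; rewrite (prox_l0_set1 prox_s (l0_cost_min_below _ x_lt)).
Qed.

End HardThreshold.

Lemma subvec_eq0 (R : realType) (m : nat) (T : {set 'I_m}) (x : 'cV[R]_m) :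
  subvec T x = 0 <-> forall i, i \in T -> x i 0 = 0.
Proof.
split=> [x0 i iT|x0]; last first.
  by apply/matrixP => k j; rewrite !mxE x0 // enum_valP.
by have /matrixP/(_ (enum_rank_in iT i) 0) := x0; rewrite !mxE enum_rankK_in.
Qed.

Lemma F_gamma_eq0 (R : realType) (p m : nat) (E : 'I_m -> 'M[R]_p)
    (mu tau : R) (Sigma : 'M[R]_p) (l s : 'cV[R]_m) (T : {set 'I_m}) :
  F_gamma E mu tau Sigma l s T = 0 <->
  [/\ g_l E mu tau Sigma l s = 0,
      forall i, i \in T -> g_s E mu tau Sigma l s i 0 = 0
    & forall i, i \notin T -> s i 0 = 0].
Proof.
have F0 : F_gamma E mu tau Sigma l s T = 0 <->
    col_mx (g_l E mu tau Sigma l s)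
      (col_mx (subvec T (g_s E mu tau Sigma l s)) (subvec (~: T) s)) = 0.
  (* Eliminating the dimension equality makes the cast the identity. *)
  by rewrite /F_gamma; case: _ / (F_dim T).
rewrite F0; split=> [/eqP|[-> g0 s0]].
  rewrite !col_mx_eq0 => /and3P[/eqP gl0 /eqP/subvec_eq0 g0 /eqP/subvec_eq0 s0].
  by split=> // i iT; apply: s0; rewrite inE.
apply/eqP; rewrite !col_mx_eq0 eqxx /=; apply/andP; split; apply/eqP/subvec_eq0 => //.
by move=> i; rewrite inE => /s0.
Qed.

Lemma grad_stepE (R : realType) (m : nat) (gamma : R) (s g : 'cV[R]_m) i :
  (s - gamma *: g) i 0 = s i 0 - gamma * g i 0.
Proof. by rewrite !mxE. Qed.

Theorem theorem2 (R : realType) (p : nat) (hp : (1 <= p)%N)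
    (E : 'I_(symdim p) -> 'M[R]_p) (hE : orthonormal_sym_basis E)
    (C mu tau gamma : R)
    (hC : 0 < C) (hmu : 0 < mu) (htau : 0 < tau) (hgamma : 0 < gamma)
    (Sigma : 'M[R]_p) (hSigma : posdef Sigma) :
  (forall l s : 'cV[R]_(symdim p),
      gamma_stationary E mu tau Sigma C gamma l s ->
      prox_l0 gamma C (s - gamma *: g_s E mu tau Sigma l s) = [set s] ->
      F_gamma E mu tau Sigma l s (T_gamma E mu tau Sigma C gamma l s) = 0)
  /\
  (forall l s : 'cV[R]_(symdim p),
      domD E (l, s) ->
      F_gamma E mu tau Sigma l s (T_gamma E mu tau Sigma C gamma l s) = 0 ->
      gamma_stationary E mu tau Sigma C gamma l s).
Proof.
split=> l s.
- move=> [_ gl0 _] prox_s; apply/F_gamma_eq0; split=> // i; rewrite inE.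
  + rewrite -grad_stepE => /(prox_l0_set1_above hC hgamma prox_s)/eqP.
    (* The fixed-point equation for coordinate [i] reduces to gamma times the partial derivative
       being 0, and gamma is nonzero. *)
    by rewrite grad_stepE -subr_eq0 subKr mulf_eq0 gt_eqF //= => /eqP.
  + by rewrite -ltNge -grad_stepE => /(prox_l0_set1_below hgamma prox_s).
- move=> ls_dom /F_gamma_eq0[gl0 g0 s0]; split=> //; apply/prox_l0P => i t.
  have [iT|iT] := boolP (i \in T_gamma E mu tau Sigma C gamma l s).
  (* On [T_gamma] the partial derivative vanishes, so the gradient step fixes the coordinate, which
     is then its own best value. *)
  + have <- : (s - gamma *: g_s E mu tau Sigma l s) i 0 = s i 0.
      by rewrite grad_stepE g0 // mulr0 subr0.
    by apply: l0_cost_min_above => //; rewrite grad_stepE; move: iT; rewrite inE.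
  + rewrite s0 //; apply: l0_cost_min_below => //.
    by rewrite grad_stepE ltNge; move: iT; rewrite inE.
Qed.
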